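(* For a vector $\boldsymbol w=(w_\gamma)_{\gamma\in\mathcal D_4}$ with $w_\gamma\ge0$ for every $\gamma\in\mathcal D_4$ and $\sum_{\gamma\in\mathcal D_4}w_\gamma=1$, define the operator $\Theta_{\boldsymbol w}:\mathcal C\to\mathcal C$ by $$\Theta_{\boldsymbol w}(C)=\sum_{\gamma\in\mathcal D_4}w_\gamma C^\gamma,\qquad C\in\mathcal C.$$ Then $\Theta=\Theta_{\boldsymbol w}$ satisfies all three of the conditions (S1) $\Theta(C^\gamma)=\Theta(C)^\gamma$ for every $C\in\mathcal C$ and $\gamma\in\mathcal D_4$, (S2) $\Theta(\Pi)=\Pi$ and $\Theta(M)=M$, (S3) $Q(\Theta(C),D)=Q(C,\Theta(D))$ for every $C,D\in\mathcal C$, if and only if $$w_\pi=w_{\pi\circ\varrho}\qquad\text{and}\qquad w_{\sigma_1}=w_{\sigma_2}=w_{\sigma_1\circ\pi}=w_{\pi\circ\sigma_1}=0 .$$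
   Context: $\mathcal C$ is the set of all bivariate copulas; $\mu_C$ is the Borel probability measure on $[0,1]^2$ associated with $C\in\mathcal C$. $M(u,v)=\min(u,v)$, $\Pi(u,v)=uv$. For $C,D\in\mathcal C$, $Q(C,D)=4\int_{[0,1]^2}C\,\mathrm d\mu_D-1$. $\mathcal D_4$ is the symmetry group of $[0,1]^2$ generated by $\pi(u,v)=(v,u)$ and $\sigma_1(u,v)=(1-u,v)$ under composition. With $\sigma_2=\pi\circ\sigma_1\circ\pi$, i.e. $\sigma_2(u,v)=(u,1-v)$, and $\varrho=\sigma_1\circ\sigma_2$, i.e. $\varrho(u,v)=(1-u,1-v)$, its eight elements are $\mathrm{id},\pi,\sigma_1,\sigma_2,\varrho,\sigma_1\circ\pi,\pi\circ\sigma_1,\pi\circ\varrho$. For $\gamma\in\mathcal D_4$ and $C\in\mathcal C$, $C^\gamma$ is the copula with $\mu_{C^\gamma}=\gamma_\#\mu_C$, where $\gamma_\#\mu(A)=\mu(\gamma^{-1}(A))$. *)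

(* Defs.v *)
From HB Require Import structures.
From mathcomp Require Import all_boot all_order all_algebra.
From mathcomp Require Import all_classical all_reals all_analysis.
From mathcomp Require Import ring.
Set Implicit Arguments.
Unset Strict Implicit.
Unset Printing Implicit Defensive.
Import Order.TTheory GRing.Theory Num.Theory.
Import numFieldNormedType.Exports.
Local Open Scope classical_set_scope.
Local Open Scope ring_scope.

Section copulas.
Context {R : realType}.
Implicit Types (C D : R * R -> R) (p : R * R).

Definition unit_square : set (R * R) := `[0, 1]%classic `*` `[0, 1]%classic.

Definition box p : set (R * R) := `[0, p.1]%classic `*` `[0, p.2]%classic.

(* A function on [0,1]^2 is represented by a total function on R * R whose
   values outside the square are irrelevant; two of them are identified when
   they agree on the square. *)
Definition eq_on_square C D := forall p, unit_square p -> C p = D p.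

Definition is_copula C :=
  [/\ forall u, 0 <= u <= 1 -> C (u, 0) = 0 /\ C (0, u) = 0,
      forall u, 0 <= u <= 1 -> C (u, 1) = u /\ C (1, u) = u &
      forall u1 u2 v1 v2, 0 <= u1 -> u1 <= u2 -> u2 <= 1 ->
        0 <= v1 -> v1 <= v2 -> v2 <= 1 ->
        0 <= C (u2, v2) - C (u2, v1) - C (u1, v2) + C (u1, v1)].

Definition copM p : R := Num.min p.1 p.2.
Definition copPi p : R := p.1 * p.2.

(* Taking p = (1, 1) shows that for a copula C such a P is carried by [0,1]^2. *)
Definition is_copula_measure C (P : probability (R * R)%type R) :=
  forall p, unit_square p -> P (box p) = (C p)%:E.

(* The measure of a copula exists and is unique; the Dirac mass is only the
   junk value for functions that are not copulas. *)
Definition mu C : probability (R * R)%type R :=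
  xget (\d_((0, 0) : R * R) : probability (R * R)%type R) (is_copula_measure C).

Definition Q C D : R := 4 * (\int[mu D]_(p in unit_square) C p) - 1.

Definition d4pi p : R * R := (p.2, p.1).
Definition sigma1 p : R * R := (1 - p.1, p.2).
Definition sigma2 : R * R -> R * R := d4pi \o sigma1 \o d4pi.
Definition rho : R * R -> R * R := sigma1 \o sigma2.

(* Closure under inverses is automatic, both generators being involutions. *)
Definition D4 : set (R * R -> R * R) :=
  smallest (fun G => G id /\ forall f g, G f -> G g -> G (f \o g))
           [set d4pi; sigma1].

Definition d4_elements : seq (R * R -> R * R) :=
  [:: id; d4pi; sigma1; sigma2; rho; sigma1 \o d4pi; d4pi \o sigma1;
      d4pi \o rho].

(* A swap (if c) followed by reflections of the first (if a) and of the second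
   (if b) coordinate: a normal form used only to prove D4E. *)
Let code (a b c : bool) p : R * R :=
  let q := if c then (p.2, p.1) else p in
  (if a then 1 - q.1 else q.1, if b then 1 - q.2 else q.2).

Let codeM a b c a' b' c' :
  code a b c \o code a' b' c' =
  code (a (+) if c then b' else a') (b (+) if c then a' else b') (c (+) c').
Proof.
by case: a; case: b; case: c; case: a'; case: b'; case: c';
  apply/funext => -[x y]; rewrite /code /=; congr pair; ring.
Qed.

Let codeE : [/\ id = code false false false, d4pi = code false false true,
  sigma1 = code true false false, sigma2 = code false true false &
  [/\ rho = code true true false, sigma1 \o d4pi = code true false true,
  d4pi \o sigma1 = code false true true & d4pi \o rho = code true true true]].
Proof. by split; [..|split]; apply/funext => -[x y]. Qed.

Lemma D4E : D4 = [set` d4_elements].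
Proof.
have mem f : f \in d4_elements <-> exists a b c, f = code a b c.
  have [e1 e2 e3 e4 [e5 e6 e7 e8]] := codeE.
  rewrite /d4_elements e1 e6 e7 e8 e2 e3 e4 e5; split.
    rewrite !inE.
    by do 7?[case/orP => [/eqP->|]; first by do 3 eexists] => /eqP->;
       do 3 eexists.
  move=> [[] [[] [[] ->]]]; rewrite !inE eqxx ?orbT//.
apply/seteqP; split.
  apply: smallest_sub; first split.
  - exact: mem_head.
  - move=> f g /mem[a [b [c ->]]] /mem[a' [b' [c' ->]]].
    by apply/mem; rewrite codeM; do 3 eexists.
  - by move=> f [->|->] /=; rewrite !inE eqxx ?orbT.
move=> f /= fs M [[M1 MM] GM].
have Mp : M d4pi by apply: GM; left.
have Ms : M sigma1 by apply: GM; right.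
have Ms2 : M sigma2 by apply: (MM) => //; apply: (MM).
have Mr : M rho by apply: (MM).
move: fs; rewrite !inE.
by do 7?[case/orP => [/eqP->|]; first by [|apply: (MM)]] => /eqP->; apply: (MM).
Qed.

(* C^g, the copula with measure the image of mu C by g, i.e. the distribution
   function of that image measure. *)
Definition symm (g : R * R -> R * R) C : R * R -> R :=
  fun p => fine (pushforward (mu C) g (box p)).

Definition Theta (w : (R * R -> R * R) -> R) C : R * R -> R :=
  fun p => \sum_(g \in D4) w g * symm g C p.

Definition S1 (T : (R * R -> R) -> (R * R -> R)) :=
  forall C g, is_copula C -> D4 g ->
    eq_on_square (T (symm g C)) (symm g (T C)).

Definition S2 (T : (R * R -> R) -> (R * R -> R)) :=
  eq_on_square (T copPi) copPi /\ eq_on_square (T copM) copM.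

Definition S3 (T : (R * R -> R) -> (R * R -> R)) :=
  forall C D, is_copula C -> is_copula D -> Q (T C) D = Q C (T D).

End copulas.

(* Main.v *)
Require Import Defs.
From HB Require Import structures.
From mathcomp Require Import all_boot all_order all_algebra.
From mathcomp Require Import all_classical all_reals all_analysis.
From mathcomp Require Import measurable_realfun ring lra.
Import Order.TTheory GRing.Theory Num.Theory.
Import numFieldNormedType.Exports.
Set Implicit Arguments.
Unset Strict Implicit.
Unset Printing Implicit Defensive.
Local Open Scope classical_set_scope.
Local Open Scope ring_scope.

(** Every copula C has a unique measure: it is the law of a pair (U, V) with U
    uniform and V a conditional quantile, the conditional distribution functions
    being Radon-Nikodym densities of the measures with distribution functions
    [u |-> C(u, q)]; uniqueness is the pi-lambda theorem. Hence [C^(g o h) =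
    (C^h)^g] and the measure of [Theta_w(C)] is the mixture of the image
    measures. Uniformity of the marginals makes vertical lines null, which gives
    closed formulas for all eight [C^g].

    Necessity. At (1/2, 1/2) the copula M and its images under id, pi, rho and
    pi o rho take the value 1/2, its other four images the value 0, so
    [Theta(M) = M] kills the other four weights. Conjugation by sigma1 exchanges
    pi and pi o rho, so (S1), tested on a copula which is not radially
    symmetric, equates their weights.

    Sufficiency. The remaining weights are invariant under conjugation, which is
    (S1), and M and Pi are fixed by the four remaining symmetries. For such g,
    [C^g - C o g] is 0 or [u + v - 1], which has integral 0 for every copula
    measure, so that the integral of [C^g] against [mu_D] is that of C against
    the image of [mu_D] by g; this is (S3). *)

(** * Measures with a given distribution function *)

Section measure_from_cdf.
Context {R : realType}.
Implicit Types (F : R -> R) (m : {finite_measure set R -> \bar R}).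

(** Half-open intervals form a generating pi-system, and finiteness makes the mass of []a, b]] a
    difference of the masses of two half-lines. *)
Lemma eq_measure_cdf m1 m2 :
  (forall a : R, m1 `]-oo, a]%classic = m2 `]-oo, a]%classic) ->
  forall A, measurable A -> m1 A = m2 A.
Proof.
move=> m12.
have mI (m : {finite_measure set R -> \bar R}) (a b : R) :
    a <= b -> (m `]a, b]%classic = m `]-oo, b]%classic - m `]-oo, a]%classic)%E.
  move=> ab; have -> : `]a, b]%classic = `]-oo, b] `\` `]-oo, a] :> set R.
    by rewrite -[RHS]setCK setCD setCitvl setUC -[LHS]setCK setCitv.
  rewrite measureD ?setIidr//; first exact: subset_itvl.
  by rewrite -ge0_fin_numE// fin_num_measure.
apply: (measure_unique (@ocitv R) (fun n => `]- n%:R, n%:R]%classic)) => //.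
- exact: ocitvI.
- by move=> n; exact: is_ocitv.
- by rewrite bigcup_itvT.
- move=> _ [[a b] _ <-]/=; have [ab|ba] := leP a b; last first.
    by rewrite set_itv_ge ?measure0// bnd_simp -leNgt ltW.
  by rewrite !mI// !m12.
- by move=> n; rewrite -ge0_fin_numE// fin_num_measure.
Qed.

Lemma lipschitz_continuous F :
  (forall x y, x <= y -> 0 <= F y - F x <= y - x) -> continuous F.
Proof.
move=> lipF x; apply/cvgrPdist_le => e e0; near=> y.
have : `|x - y| <= e by near: y; exact: cvgr_dist_le.
apply: le_trans; case: (leP x y) => xy.
  have /andP[h1 h2] := lipF _ _ xy.
  by rewrite distrC ger0_norm// distrC ger0_norm// subr_ge0.
have /andP[h1 h2] := lipF _ _ (ltW xy).
by rewrite ger0_norm// ger0_norm// subr_ge0 ltW.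
Unshelve. all: by end_near. Qed.

(** The measure is the Stieltjes measure of [F] cut down to []0, 1]]. Since [F] is constant on
    either side, nothing is lost and finiteness is immediate. *)
Lemma measure_of_cdf F :
  (forall x y, x <= y -> 0 <= F y - F x <= y - x) ->
  (forall x : R, x <= 0 -> F x = 0) -> (forall x, 1 <= x -> F x = F 1) ->
  exists m, m setT = (F 1)%:E /\ forall a, m `]-oo, a]%classic = (F a)%:E.
Proof.
move=> lipF F0 F1.
have ndF : nondecreasing F.
  by move=> x y /lipF /andP[+ _]; rewrite subr_ge0.
have rcF : right_continuous F.
  exact/right_continuousW/lipschitz_continuous.
pose F' : cumulative R R := HB.pack F (isCumulative.Build R _ R F ndF rcF).
have mF' (a b : R) : a <= b ->
    lebesgue_stieltjes_measure F' `]a, b]%classic = (F b - F a)%:E.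
  move=> ab.
  rewrite /lebesgue_stieltjes_measure /measure_extension.
  by rewrite measurable_mu_extE/= ?wlength_itv_bnd//; exact: is_ocitv.
pose ls := lebesgue_stieltjes_measure F'.
pose ls_mixin := @isMeasure.Build _ R R ls (measure0 ls)
  (fun A => measure_ge0 ls A) (@measure_semi_sigma_additive _ _ _ ls).
pose m := HB.pack_for {measure set R -> \bar R} (ls : set R -> \bar R) ls_mixin.
have fin01 : (m `]0%R, 1%R]%classic < +oo)%E by rewrite [ltLHS]mF'// ltry.
have mD : measurable (`]0%R, 1%R]%classic : set R) by exact: measurable_itv.
have mE A : mfrestr mD fin01 A =
  lebesgue_stieltjes_measure F' (A `&` `]0, 1]%classic) by [].
exists (mfrestr mD fin01); split=> [|a]; rewrite [LHS]mE.
  by rewrite setTI mF'// (F0 0)// subr0.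
have [a0|a0] := leP a 0.
  rewrite F0// (_ : _ `&` _ = set0) ?measure0//.
  by apply/seteqP; split => // x /=; rewrite !in_itv/=; lra.
have [a1|a1] := leP a 1.
  rewrite (_ : _ `&` _ = `]0%R, a]%classic) ?mF' ?(F0 0) ?subr0// ?ltW//.
  by apply/seteqP; split => // x /=; rewrite !in_itv/=; lra.
rewrite (_ : _ `&` _ = `]0%R, 1%R]%classic).
  by rewrite mF' ?(F0 0) ?subr0// (F1 a)// ltW.
by apply/seteqP; split => // x /=; rewrite !in_itv/=; lra.
Qed.

End measure_from_cdf.

Lemma probability_of_measure d (T : measurableType d) (R : realType)
    (m : {measure set T -> \bar R}) :
  m setT = 1%E -> exists P : probability T R, P = m :> (set T -> \bar R).
Proof.
(* The Dirac mass is the default for a degenerate total mass and is not reached here. *)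
move=> m1; exists (mnormalize m \d_point); apply/funext => A.
by rewrite /= /mnormalize m1 onee_eq0/= invr1 mule1.
Qed.

(** * Domination of measures and bounded densities *)

Section measures.
Context d (T : measurableType d) (R : realType).
Variables (mu nu : {finite_measure set T -> \bar R}).

(** On the set where [g < f], the nonnegative function [f - g] has integral at most 0, so it
    vanishes almost everywhere there; hence that set is null. *)
Lemma le_density (f g : T -> R) :
  mu.-integrable setT (EFin \o f) -> mu.-integrable setT (EFin \o g) ->
  (forall A, measurable A ->
    (\int[mu]_(x in A) (f x)%:E <= \int[mu]_(x in A) (g x)%:E)%E) ->
  {ae mu, forall x, f x <= g x}.
Proof.
move=> intf intg fg.
have mf : measurable_fun setT f.
  by apply/measurable_EFinP; exact: measurable_int intf.
have mg : measurable_fun setT g.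
  by apply/measurable_EFinP; exact: measurable_int intg.
pose A := [set x | g x < f x].
have mA : measurable A.
  rewrite -[A]setTI (_ : A = (fun x => g x < f x) @^-1` [set true]).
    exact: measurable_fun_ltr.
  by apply/seteqP; split.
have : ae_eq mu A (fun x => (f x - g x)%:E) (cst 0%E).
  apply/ae_eq_integral_abs => //.
    by apply/measurable_EFinP; apply: measurable_funTS; exact: measurable_funB.
  apply/eqP; rewrite eq_le integral_ge0// andbT.
  rewrite (eq_integral (fun x => (f x)%:E - (g x)%:E)%E); last first.
    move=> x; rewrite inE /A/= => gf.
    by rewrite -EFinB/= ger0_norm// subr_ge0 ltW.
  rewrite integralB//; [|exact: integrableS intf|exact: integrableS intg].
  rewrite leeBlDr ?add0e ?fg//.
  by apply: integrable_fin_num => //; exact: integrableS intg.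
apply: filterS => x /= Ax; rewrite leNgt; apply/negP => gf.
have [] := Ax gf => /eqP; rewrite subr_eq0 => /eqP fgx.
by move: gf; rewrite fgx ltxx.
Qed.

(** The Radon-Nikodym density is at most 1 almost everywhere by [le_density]; truncating it at 1
    makes the bound hold everywhere and keeps all integrals. *)
Lemma density_le1 : (forall A, measurable A -> (nu A <= mu A)%E) ->
  exists f : T -> R, [/\ measurable_fun setT f, forall x, 0 <= f x <= 1 &
    forall A, measurable A -> (\int[mu]_(x in A) (f x)%:E = nu A)%E].
Proof.
move=> numu.
have : nu `<< mu.
  apply/null_content_dominatesP => A mA muA0.
  by apply/eqP; rewrite eq_le measure_ge0 andbT -muA0 numu.
move=> /radon_nikodym_sigma_finite[f [f0 ffin intf fnu]].
pose g x := fine (f x).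
have fg : f = EFin \o g by apply/funext => x /=; rewrite fineK.
rewrite fg in intf fnu.
have mg : measurable_fun setT g.
  by apply/measurable_EFinP; exact: measurable_int intf.
have g1 : {ae mu, forall x, g x <= 1}.
  apply: (@le_density _ (cst 1)) => //.
    exact: finite_measure_integrable_cst.
  move=> A mA; rewrite -fnu//.
    by rewrite (integral_cst mu mA 1%E) mul1e numu.
exists (fun x => Num.min (g x) 1); split.
- exact: measurable_minr.
- by move=> x; rewrite le_min ge_min fine_ge0// lexx ler01 orbT.
- move=> A mA; rewrite fnu//; apply: ge0_ae_eq_integral => //.
  + apply/measurable_EFinP; apply: measurable_funTS; exact: measurable_minr.
  + apply/measurable_EFinP; exact: measurable_funTS.
  + by move=> x _; rewrite lee_fin le_min fine_ge0// ler01.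
  + by move=> x _; rewrite lee_fin fine_ge0.
  + by apply: filterS g1 => x gx1 Ax; rewrite min_l.
Qed.

End measures.

Lemma le_measure_cdf (R : realType)
    (m m1 m2 : {finite_measure set R -> \bar R}) :
  (forall a : R, m `]-oo, a]%classic =
    m1 `]-oo, a]%classic + m2 `]-oo, a]%classic)%E ->
  forall A, measurable A -> (m1 A <= m A)%E.
Proof.
move=> mD A mA.
(* Restricting to the whole space only serves to package the sum as a finite measure. *)
have fin12 : (measure_add m1 m2 setT < +oo)%E.
  by rewrite measure_addE lte_add_pinfty// -ge0_fin_numE// fin_num_measure.
have m12E B : mfrestr measurableT fin12 B = (m1 B + m2 B)%E.
  by rewrite /mfrestr /mrestr setIT measure_addE.
rewrite (@eq_measure_cdf _ m (mfrestr measurableT fin12)) => [|a|//].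
  by rewrite [leRHS]m12E leeDl.
by rewrite mD [RHS]m12E.
Qed.

(** * Existence of the measure of a copula *)

Section clamp.
Context {R : realType}.

(** This is the distribution function of the uniform law on [[0, 1]]; it also brings arguments into
    the range where the copula axioms apply. *)
Definition clamp (x : R) : R := Num.min (Num.max 0 x) 1.

Lemma clamp01 x : 0 <= clamp x <= 1.
Proof. by rewrite le_min ge_min le_max !lexx ler01 ?orbT. Qed.

Lemma clamp_le0 x : x <= 0 -> clamp x = 0.
Proof. by move=> x0; rewrite /clamp max_l// min_l. Qed.

Lemma clamp_id x : 0 <= x <= 1 -> clamp x = x.
Proof. by move=> /andP[x0 x1]; rewrite /clamp max_r// min_l. Qed.

Lemma clamp_ge1 x : 1 <= x -> clamp x = 1.
Proof. by move=> x1; rewrite /clamp max_r ?min_r ?(le_trans ler01). Qed.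

Lemma clamp_lipschitz x y : x <= y -> 0 <= clamp y - clamp x <= y - x.
Proof.
have clampP z : z <= 0 /\ clamp z = 0 \/ 0 <= z <= 1 /\ clamp z = z \/
    1 <= z /\ clamp z = 1.
  have [/clamp_le0|z0] := leP z 0; first by left.
  have [z1|/ltW z1] := leP z 1; last by right; right; rewrite clamp_ge1.
  by right; left; rewrite clamp_id ltW.
by have [[? ->]|[[? ->]|[? ->]]] := clampP x;
  have [[? ->]|[[? ->]|[? ->]]] := clampP y; lra.
Qed.

End clamp.

Section copula_densities.
Context {R : realType}.
Variable C : R * R -> R.
Hypothesis hC : is_copula C.

(** The strip between heights [v] and [v'] is cut at [u]: the two pieces have nonnegative volumes
    with sum [v' - v]. *)
Lemma copula_lipschitz u v v' : 0 <= u <= 1 -> 0 <= v -> v <= v' -> v' <= 1 ->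
  0 <= C (u, v') - C (u, v) <= v' - v.
Proof.
have [C0 C1 C2] := hC => /andP[u0 u1] v0 vv' v1.
have [v01 v01'] : 0 <= v <= 1 /\ 0 <= v' <= 1 by split; lra.
have := C2 0 u v v' (lexx _) u0 u1 v0 vv' v1.
have := C2 u 1 v v' u0 u1 (lexx _) v0 vv' v1.
rewrite (C1 _ v01).2 (C1 _ v01').2 (C0 _ v01).2 (C0 _ v01').2; lra.
Qed.

(** This measure plays the role of the law of U on the event q < V <= q', before any pair (U, V)
    exists. *)
Lemma copula_strip_measure q q' : 0 <= q -> q <= q' -> q' <= 1 ->
  exists m : {finite_measure set R -> \bar R},
    m setT = (q' - q)%:E /\
    forall a : R, m `]-oo, a]%classic =
      (C (clamp a, q') - C (clamp a, q))%:E.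
Proof.
have [C0 C1 C2] := hC => q0 qq' q1.
have [q01 q01'] : 0 <= q <= 1 /\ 0 <= q' <= 1 by split; lra.
have [||x|m [mT mE]] :=
    @measure_of_cdf R (fun a => C (clamp a, q') - C (clamp a, q)).
- move=> x y xy; have := clamp_lipschitz xy.
  have := clamp01 x; have := clamp01 y.
  move: (clamp x) (clamp y) => cx cy cy01 cx01 cxy.
  have [cx0 cy1 cxcy] : [/\ 0 <= cx, cy <= 1 & cx <= cy] by split; lra.
  (* The volumes of the column over [[cx, cy]] between heights 0, [q], [q'] and 1 are nonnegative
     and add up to [cy - cx]. *)
  have := C2 cx cy q q' cx0 cxcy cy1 q0 qq' q1.
  have := C2 cx cy 0 q cx0 cxcy cy1 (lexx _) q0 (le_trans qq' q1).
  have := C2 cx cy q' 1 cx0 cxcy cy1 (le_trans q0 qq') q1 (lexx _).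
  rewrite (C1 _ cx01).1 (C1 _ cy01).1 (C0 _ cx01).1 (C0 _ cy01).1; lra.
- move=> x x0; by rewrite clamp_le0// (C0 _ q01).2 (C0 _ q01').2 subrr.
- by move=> x1; rewrite !clamp_ge1.
- exists m; split=> //.
  by rewrite mT clamp_id ?lexx ?ler01// (C1 _ q01).2 (C1 _ q01').2.
Qed.

(* [f q] is a version of the conditional distribution function
   [P(V <= q | U = x)]. *)
Lemma copula_densities : exists (mu : probability R R) (f : R -> R -> R),
  [/\ forall a : R, mu `]-oo, a]%classic = (clamp a)%:E,
      forall q, measurable_fun setT (f q) /\ forall x, 0 <= f q x <= 1,
      forall q (a : R), 0 <= q <= 1 ->
        (\int[mu]_(x in `]-oo, a]%classic) (f q x)%:E = (C (clamp a, q))%:E)%E &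
      forall q q', 0 <= q -> q <= q' -> q' <= 1 ->
        {ae mu, forall x, f q x <= f q' x}].
Proof.
have [C0 C1 C2] := hC.
have [mu0 [mu0T mu0E]] := copula_strip_measure (lexx 0) ler01 (lexx 1).
have mu1 : mu0 setT = 1%E by rewrite mu0T subr0.
have [mu muE'] := probability_of_measure mu1.
have muE a : mu `]-oo, a]%classic = (clamp a)%:E.
  have ca := clamp01 a.
  by rewrite muE' [LHS]mu0E (C1 _ ca).1 (C0 _ ca).1 subr0.
(* [choice] needs a measure for every real [q]; outside [[0, 1]] it is the junk value [mu0]. *)
have /choice[nu nuE] q : exists m : {finite_measure set R -> \bar R},
    0 <= q <= 1 -> forall a : R, m `]-oo, a]%classic = (C (clamp a, q))%:E.
  have [/andP[q0 q1]|] := boolP (0 <= q <= 1); last by exists mu0.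
  have [m [_ mE]] := copula_strip_measure (lexx 0) q0 q1.
  by exists m => _ a; rewrite mE (C0 _ (clamp01 a)).1 subr0.
have nu_le q q' : 0 <= q -> q <= q' -> q' <= 1 ->
    forall A, measurable A -> (nu q A <= nu q' A)%E.
  move=> q0 qq' q1; have [m [_ mE]] := copula_strip_measure q0 qq' q1.
  apply: (@le_measure_cdf _ _ _ m) => a.
  by rewrite mE !nuE ?q0 ?q1 ?(le_trans q0 qq') ?(le_trans qq' q1)// -EFinD subrKC.
(* Level 1 gives the uniform law itself, so each [nu q] with [q] in [[0, 1]] is dominated by [mu]
   and has a density with values in [[0, 1]]. *)
have mu_nu A : measurable A -> nu 1 A = mu A.
  apply: (@eq_measure_cdf _ (nu 1) mu) => a.
  by rewrite [RHS]muE nuE ?ler01 ?lexx// (C1 _ (clamp01 a)).1.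
have /choice[f fP] q : exists g : R -> R, [/\ measurable_fun setT g,
    forall x, 0 <= g x <= 1 & 0 <= q <= 1 ->
    forall A, measurable A -> (\int[mu]_(x in A) (g x)%:E = nu q A)%E].
  have [/andP[q0 q1]|] := boolP (0 <= q <= 1); last first.
    by exists (cst 0); split => // x; rewrite lexx ler01.
  have [A mA|g [mg g01 gE]] := @density_le1 _ _ R mu (nu q).
    by have := nu_le _ _ q0 q1 (lexx _) A mA; rewrite mu_nu.
  by exists g.
exists mu, f; split=> // [q|q a q01|q q' q0 qq' q1].
- by have [] := fP q.
- by have [_ _ ->//] := fP q; rewrite nuE.
- have intf r : mu.-integrable setT (EFin \o f r).
    have [mf f01 _] := fP r.
    apply: (@le_integrable _ _ _ mu _ measurableT _ (EFin \o cst 1)).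
    + exact/measurable_EFinP.
    + move=> x _; have /andP[f0 f1] := f01 x.
      by rewrite /= lee_fin normr1 ger0_norm.
    + exact: finite_measure_integrable_cst.
  apply: le_density => // A mA.
  have [_ _ ->//] := fP q; last lra.
  have [_ _ ->//] := fP q'; last lra.
  exact: nu_le.
Qed.

End copula_densities.

Section existence.
Context {R : realType}.
Variable C : R * R -> R.
Hypothesis hC : is_copula C.

(** Countably many levels allow the exceptional null sets of the almost sure inequalities to be
    united. Clamping leaves the rationals of [[0, 1]] unchanged. *)
Lemma rational_enumeration : exists q_ : nat -> R,
  (forall n, 0 <= q_ n <= 1) /\
  forall x y : R, 0 <= x -> x < y -> y <= 1 -> exists n, x < q_ n < y.
Proof.
exists (fun n => clamp (ratr (odflt 0 (unpickle n)))); split=> [n|x y x0 xy y1].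
  exact: clamp01.
have [q] := rat_in_itvoo xy; rewrite in_itv/= => /andP[xq qy].
exists (pickle q); rewrite pickleK/= clamp_id ?xq ?qy//.
by rewrite (le_trans x0 (ltW xq)) (le_trans (ltW qy) y1).
Qed.

(* With [x] and [y] independent and uniform, take [U = x] and let [V] be the
   quantile function of the conditional law given [U = x], evaluated at [y]. *)
Lemma copula_measure_exists : exists P, is_copula_measure C P.
Proof.
have [C0 C1 _] := hC.
have [mu [f [muE f01 intf fle]]] := copula_densities hC.
have [q_ [q01 q_dense]] := rational_enumeration.
pose P : probability (R * R)%type R := (mu \x mu)%E.
(* A level counts when the conditional distribution function has reached [p.2] there, and otherwise
   contributes the top value 1; the infimum over [n] is the quantile. *)
pose h n (p : R * R) : R := if p.2 <= f (q_ n) p.1 then q_ n else 1.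
have h01 n p : 0 <= h n p <= 1.
  by rewrite /h; case: ifP => // _; rewrite ler01 lexx.
have h_lb p : has_lbound (range (h ^~ p)).
  by exists 0 => _ [n _ <-]; have /andP[] := h01 n p.
pose V p := infs (h ^~ p) 0.
have VE p : V p = inf (range (h ^~ p)).
  by rewrite /V /infs/=; congr inf; apply/seteqP; split => x [n _ <-]; exists n.
have V0 p : 0 <= V p.
  rewrite VE; apply: lb_le_inf; first by exists (h 0%N p), 0%N.
  by move=> _ [n _ <-]; have /andP[] := h01 n p.
have V_le n p : V p <= h n p by rewrite VE; apply: ge_inf => //; exists n.
have V_lt p v : V p < v -> exists n, h n p < v.
  rewrite VE => /inf_lt[|_ [n _ <-] hv]; first by exists (h 0%N p), 0%N.
  by exists n.
have mle q : measurable_fun setT (fun p : R * R => p.2 <= f q p.1).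
  apply: measurable_fun_ler => //.
  by apply: (@measurableT_comp _ _ _ _ _ _ (f q)) => //; have [] := f01 q.
have mV : measurable_fun setT V.
  apply: measurable_fun_infs => // n.
  by apply: measurable_fun_if => //; exact: mle.
(* With the maximum, [X] lies in [box (u, v)] exactly when [p.1 <= u] and [V p <= v], with no null
   set to discard. *)
pose X (p : R * R) := (Num.max 0 p.1, V p).
have mX : measurable_fun setT X.
  by apply: measurable_fun_pair => //; exact: measurable_maxr.
pose G u q := [set p : R * R | p.1 <= u /\ p.2 <= f q p.1].
(* The inequality is strict because an infimum below [v] is witnessed by some level below [v]. *)
pose E u v := [set p : R * R | p.1 <= u /\ V p < v].
have mset (b : R * R -> bool) : measurable_fun setT b -> measurable [set p | b p].
  move=> mb; rewrite -[X in measurable X]setTI.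
  rewrite (_ : mkset _ = b @^-1` [set true]); last by apply/seteqP; split.
  exact: mb.
have mhalf (u : R) : measurable [set p : R * R | p.1 <= u].
  by apply: mset; apply: measurable_fun_ler.
have mG u q : measurable (G u q).
  apply: measurableI; first exact: mhalf.
  by apply: mset; apply: mle.
have mE u v : measurable (E u v).
  apply: measurableI; first exact: mhalf.
  by apply: mset; apply: measurable_fun_ltr.
have PG u q : 0 <= u <= 1 -> 0 <= q <= 1 -> P (G u q) = (C (u, q))%:E.
  move=> u01 q01'; rewrite -[in RHS](clamp_id u01) -intf// integral_mkcond.
  apply: eq_integral => x _ /=; rewrite patchE mem_setE in_itv/=.
  case: ifPn => xu.
    rewrite (_ : xsection _ _ = `]-oo, f q x]%classic).
      by rewrite muE clamp_id//; have [_ ->] := f01 q.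
    by apply/seteqP; split => y; rewrite /xsection/= inE /G/= in_itv/= => // -[].
  rewrite (_ : xsection _ _ = set0) ?measure0//.
  apply/seteqP; split => y //; rewrite /xsection/= inE /G/= => -[xu'].
  by rewrite xu' in xu.
have PE_le u v : 0 <= u <= 1 -> 0 <= v <= 1 -> (P (E u v) <= (C (u, v))%:E)%E.
  move=> u01 /andP[v0 v1]; rewrite -PG ?v0//.
  (* Off a single null set of abscissas, a level below [v] that witnesses [E u v] puts the point in
     [G u v]. *)
  have fle_v : {ae mu, forall x, forall n, q_ n < v -> f (q_ n) x <= f v x}.
    apply: ae_foralln => n; have [qv|qv] := ltP (q_ n) v; last first.
      by apply: aeW => x.
    have /andP[q0 q1] := q01 n.
    by apply: filterS (fle _ _ q0 (ltW qv) v1) => x + _.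
  apply: ae_ge0_le_integral => //.
  - exact: measurable_fun_xsection.
  - exact: measurable_fun_xsection.
  - apply: filterS fle_v => x fx _ /=; apply: le_measure.
    + by rewrite inE; exact: measurable_xsection.
    + by rewrite inE; exact: measurable_xsection.
    + move=> y; rewrite /xsection/= !inE /E /G/= => -[xu /V_lt[n]].
      rewrite /h/=; case: ifPn => [yf qv|_]; last by rewrite ltNge v1.
      by split=> //; apply: le_trans yf (fx _ qv).
have PE_ge u v : 0 <= u <= 1 -> 0 <= v <= 1 -> ((C (u, v))%:E <= P (E u v))%E.
  (* For positive [v], a level [q_ n] within [e] below [v] gives [G u (q_ n)] inside [E u v], at a
     Lipschitz cost of at most [e]. *)
  move=> u01 v01; have [v0|v0] := eqVneq v 0.
    by rewrite v0 (C0 _ u01).1.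
  apply/lee_addgt0Pr => e e0.
  have v_gt0 : 0 < v by rewrite lt_neqAle eq_sym v0; case/andP: v01.
  have [|||n /andP[]] := q_dense (Num.max 0 (v - e)) v.
  - by rewrite le_max lexx.
  - by rewrite gt_max v_gt0 ltrBlDr ltrDl.
  - by case/andP: v01.
  rewrite gt_max => /andP[q0 vq] qv.
  have := copula_lipschitz hC u01 (ltW q0) (ltW qv).
  have /andP[_ v1] := v01 => /(_ v1) /andP[_ Cvq].
  apply: (@le_trans _ _ (P (G u (q_ n)) + e%:E)%E).
    by rewrite PG// -EFinD lee_fin; lra.
  rewrite leeD2r//; apply: le_measure; rewrite ?inE//.
  move=> p [pu pf]; split=> //; apply: le_lt_trans (V_le n p) _.
  by rewrite /h pf.
pose X' : {mfun (R * R)%type >-> (R * R)%type} :=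
  HB.pack X (isMeasurableFun.Build _ _ _ _ X mX).
exists (distribution P X') => -[u v] [/=]; rewrite !in_itv/= => u01 v01.
have PbE : distribution P X' (box (u, v)) = P [set p | p.1 <= u /\ V p <= v].
  congr (P _); apply/seteqP; split=> [p [/=]|p [/= pu pv]].
    by rewrite !in_itv/= ge_max => /andP[_ /andP[_ ->]] /andP[_ ->].
  split=> /=; rewrite !in_itv/= ?V0//.
  by rewrite le_max lexx ge_max pu; case/andP: u01 => ->.
have mEle : measurable [set p | p.1 <= u /\ V p <= v].
  apply: measurableI; first exact: mhalf.
  by apply: mset; apply: measurable_fun_ler.
rewrite [LHS]PbE; apply/eqP; rewrite eq_le; apply/andP; split; last first.
  apply: le_trans (PE_ge _ _ u01 v01) _; apply: le_measure; rewrite ?inE//.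
  by move=> p [pu pv]; split=> //; exact: ltW.
(* At [v = 1] no higher level is available and the uniform first marginal gives the bound. For
   [v < 1], the condition [V p <= v] is relaxed to [V p < v'] with [v'] at most [v + e]. *)
have [v1|v1] := ltP v 1; last first.
  have {}v1 : v = 1 by apply/eqP; rewrite eq_le v1; case/andP: v01 => _ ->.
  rewrite v1 in mEle *.
  have mu_u : measurable (`]-oo, u]%classic `*` [set: R]) by exact: measurableX.
  have <- : P (`]-oo, u]%classic `*` [set: R]) = (C (u, 1))%:E.
    transitivity (mu `]-oo, u]%classic * mu setT)%E.
      exact: product_measure1E.
    by rewrite probability_setT mule1 muE clamp_id// (C1 _ u01).1.
  apply: le_measure; rewrite ?inE//.
  by move=> p [pu _]; split=> //=; rewrite in_itv.
apply/lee_addgt0Pr => e e0; pose v' := Num.min 1 (v + e).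
have v'1 : v' <= 1 by rewrite ge_min lexx.
have v'e : v' <= v + e by rewrite ge_min lexx orbT.
have vv' : v < v' by rewrite lt_min v1 ltrDl.
have v0 : 0 <= v by case/andP: v01.
apply: (@le_trans _ _ (P (E u v'))).
  apply: le_measure; rewrite ?inE//.
  by move=> p [pu pv]; split=> //; exact: le_lt_trans vv'.
apply: le_trans (PE_le _ _ u01 _) _; first by rewrite v'1 (le_trans v0 (ltW vv')).
have /andP[_] := copula_lipschitz hC u01 v0 (ltW vv') v'1.
by rewrite -EFinD lee_fin; lra.
Qed.

End existence.

(** * Uniqueness of the measure of a copula *)

Lemma probability_setI d (T : measurableType d) (R : realType)
    (P : probability T R) (N A : set T) : measurable N -> P N = 1%E ->
  measurable A -> P A = P (A `&` N).
Proof.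
move=> mN PN mA.
have mAN : measurable (A `&` N) by exact: measurableI.
have mNC : measurable (~` N) by exact: measurableC.
apply/eqP; rewrite eq_le; apply/andP; split; last first.
  by apply: le_measure; rewrite ?inE.
have PC : P (~` N) = 0%E by rewrite probability_setC// PN subee.
rewrite -[leRHS]adde0 -PC; apply: le_trans (measureU2 _ mAN mNC).
apply: le_measure; rewrite ?inE//; first exact: measurableU.
by move=> x Ax; have [?|?] := pselect (N x); [left|right].
Qed.

Section uniqueness.
Context {R : realType}.
Implicit Types (P : probability (R * R)%type R).

Lemma measurable_box p : measurable (@box R p).
Proof. by apply: measurableX; exact: measurable_itv. Qed.

(** Freezing one side of a rectangle leaves a finite measure on the line, to which [eq_measure_cdf]
    applies. *)
Lemma measure_of_cylinder P B : measurable B ->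
  exists m : {finite_measure set R -> \bar R}, forall A, m A = P (A `*` B).
Proof.
move=> mB.
have mD : measurable ([set: R] `*` B) by exact: measurableX.
have Dfin : (P ([set: R] `*` B) < +oo)%E by rewrite -ge0_fin_numE// fin_num_measure.
pose F := pushforward (mfrestr mD Dfin) (@fst R R).
have mfst : measurable_fun setT (@fst R R) by [].
pose m_ := HB.pack_for {measure set R -> \bar R} F.
pose m := m_ mfst.
have mE A : m A = P (A `*` B).
  congr (P _); apply/seteqP; split=> [p [? []//]|p []//].
have mfin : (m setT < +oo)%E by rewrite mE.
exists (mfrestr measurableT mfin) => A.
by rewrite -[RHS]mE -[X in _ = m X]setIT.
Qed.

(** Full mass on the square reduces quadrants to boxes. The sides are then extended from half-lines
    to Borel sets one at a time, and measurable rectangles form a generating pi-system. *)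
Lemma eq_probability_box P1 P2 : P1 (box (1, 1)) = 1%E ->
  (forall p, unit_square p -> P1 (box p) = P2 (box p)) ->
  forall A, measurable A -> P1 A = P2 A.
Proof.
move=> P11 P12.
have sq1 : @unit_square R (1, 1) by split; rewrite /= in_itv/= ler01 lexx.
have P21 : P2 (box (1, 1)) = 1%E by rewrite -P12.
have mN := measurable_box (1, 1).
have quadrant (a b : R) : P1 (`]-oo, a]%classic `*` `]-oo, b]%classic) =
    P2 (`]-oo, a]%classic `*` `]-oo, b]%classic).
  have mq : measurable (`]-oo, a]%classic `*` `]-oo, b]%classic : set (R * R)).
    by apply: measurableX; exact: measurable_itv.
  rewrite (probability_setI mN P11 mq) (probability_setI mN P21 mq).
  have [a0|a0] := ltP a 0.
    rewrite (_ : _ `&` _ = set0) ?measure0//; apply/seteqP; split=> // x [[]].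
    rewrite /box/= !in_itv/= => xa _ [/andP[x0 _] _].
    by have := le_trans x0 xa; rewrite leNgt a0.
  have [b0|b0] := ltP b 0.
    rewrite (_ : _ `&` _ = set0) ?measure0//; apply/seteqP; split=> // x [[]].
    rewrite /box/= !in_itv/= => _ xb [_ /andP[x0 _]].
    by have := le_trans x0 xb; rewrite leNgt b0.
  rewrite (_ : _ `&` _ = box (Num.min a 1, Num.min b 1)).
    by apply: P12; split; rewrite /= in_itv/= le_min ge_min lexx ler01 orbT ?a0 ?b0.
  apply/seteqP; split=> x; rewrite /box/setX/= !in_itv/= !le_min.
    by move=> [[-> ->] [/andP[-> ->] /andP[-> ->]]].
  by move=> [/andP[-> /andP[-> ->]] /andP[-> /andP[-> ->]]].
have half A (b : R) : measurable A -> P1 (A `*` `]-oo, b]%classic) =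
    P2 (A `*` `]-oo, b]%classic).
  move=> mA; have mb : measurable (`]-oo, b]%classic : set R) by [].
  have [m1 m1E] := measure_of_cylinder P1 mb.
  have [m2 m2E] := measure_of_cylinder P2 mb.
  rewrite -m1E -m2E; apply: eq_measure_cdf mA => a.
  by rewrite m1E m2E.
have rectangle A B : measurable A -> measurable B -> P1 (A `*` B) = P2 (A `*` B).
  move=> mA mB.
  (* Exchanging coordinates lets the second side be treated by the same cylinder lemma. *)
  pose swap (p : R * R) := (p.2, p.1).
  have mswap : measurable_fun setT swap by exact: measurable_fun_pair.
  pose swap' : {mfun (R * R)%type >-> (R * R)%type} :=
    HB.pack swap (isMeasurableFun.Build _ _ _ _ swap mswap).
  have swapE P X Y : distribution P swap' (Y `*` X) = P (X `*` Y).
    by congr (P _); apply/seteqP; split=> p [].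
  have [m1 m1E] := measure_of_cylinder (distribution P1 swap') mA.
  have [m2 m2E] := measure_of_cylinder (distribution P2 swap') mA.
  rewrite -(swapE P1) -(swapE P2) -m1E -m2E; apply: eq_measure_cdf mB => b.
  by rewrite m1E m2E [LHS]swapE [RHS]swapE half.
apply: (measure_unique [set A `*` B | A in measurable & B in measurable]
  (fun=> setT)) => //.
- exact: measurable_prod_measurableType.
- move=> _ _ [A1 mA1 [B1 mB1 <-]] [A2 mA2 [B2 mB2 <-]].
  exists (A1 `&` A2); first exact: measurableI.
  by exists (B1 `&` B2); [exact: measurableI|rewrite setXI].
- by move=> _; exists setT => //; exists setT => //; rewrite setXTT.
- by rewrite bigcup_const//; exists 0%N.
- by move=> _ [A mA [B mB <-]]; exact: rectangle.
- by move=> n; rewrite -ge0_fin_numE// fin_num_measure.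
Qed.

End uniqueness.

(** * The action of the symmetry group on copulas *)

Section symmetries.
Context {R : realType}.
Implicit Types (C D : R * R -> R) (g h : R * R -> R * R) (p : R * R).
Implicit Types (P : probability (R * R)%type R).

Lemma measurable_D4 g : D4 g -> measurable_fun setT g.
Proof.
have D4_sub : D4 `<=` [set g : R * R -> R * R | measurable_fun setT g].
  apply: smallest_sub; first split.
  - exact: measurable_id.
  - by move=> f f' mf mf'; exact: measurableT_comp.
  - move=> f [|] -> /=; apply: measurable_fun_pair => //.
    by apply: measurable_funB => //; exact: measurable_cst.
exact: D4_sub.
Qed.

Lemma preimage_D4_square g : D4 g -> g @^-1` unit_square = unit_square.
Proof.
have D4_sub : D4 `<=` [set g | g @^-1` unit_square = @unit_square R].
  apply: smallest_sub; first split => //.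
  - by move=> f f' /= Sf Sf'; rewrite comp_preimage Sf.
  - move=> f [|] -> /=; apply/seteqP; split=> p [];
      by rewrite /= !in_itv/= => ? ?; split; rewrite /= in_itv/=; lra.
exact: D4_sub.
Qed.

Lemma D4_square g p : D4 g -> unit_square p -> unit_square (g p).
Proof. by move=> Dg; rewrite -[in X in X -> _](preimage_D4_square Dg). Qed.

Lemma D4_uniq : uniq (@d4_elements R).
Proof.
pose z : int * int -> R * R := fun k => (k.1%:~R, k.2%:~R).
have z_inj : injective z.
  by move=> [a b] [a' b'] [] /intr_inj -> /intr_inj ->.
(* The point (3, 5) lies on no axis of symmetry and has eight distinct images; integer coordinates
   make their distinctness computable. *)
apply: (@map_uniq _ _ (fun g => g (z (3, 5)))).
rewrite (_ : map _ _ = map z [:: (3, 5); (5, 3); (-2, 5); (3, -4); (-2, -4);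
  (-4, 3); (5, -2); (-4, -2)])%Z ?map_inj_uniq//.
by rewrite /= /z /rho /sigma2 /sigma1 /d4pi/=; congr [:: _; _; _; _; _; _; _; _];
  congr pair; ring.
Qed.

Lemma D4_mem g : D4 g <-> g \in d4_elements.
Proof. by rewrite D4E. Qed.

Lemma ThetaE w C p : Theta w C p = \sum_(g <- d4_elements) w g * symm g C p.
Proof. by rewrite /Theta D4E -fsbig_seq//; exact: D4_uniq. Qed.

Lemma pushforward_probability P g : measurable_fun setT g ->
  exists P' : probability (R * R)%type R,
    P' = pushforward P g :> (set (R * R) -> \bar R).
Proof.
move=> mg.
pose g' : {mfun (R * R)%type >-> (R * R)%type} :=
  HB.pack g (isMeasurableFun.Build _ _ _ _ g mg).
by exists (distribution P g').
Qed.

Lemma unit_square11 : @unit_square R (1, 1).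
Proof. by split; rewrite /= in_itv/= ler01 lexx. Qed.

(** Assuming the mass of the square instead of [is_copula C] lets this apply to [symm g C] and
    [Theta w C] directly. *)
Lemma mu_unique C P : P unit_square = 1%E -> is_copula_measure C P ->
  forall A, measurable A -> mu C A = P A.
Proof.
move=> P1 CP A mA; apply/esym; apply: eq_probability_box => // p sp.
have muC : is_copula_measure C (mu C) by rewrite /mu; apply: xgetPex; exists P.
by rewrite CP// muC.
Qed.

Lemma copula_muE C : is_copula C -> is_copula_measure C (mu C).
Proof.
by move=> hC; rewrite /mu; apply: xgetPex; exact: copula_measure_exists.
Qed.

Lemma copula_mu_square C : is_copula C -> mu C unit_square = 1%E.
Proof.
move=> hC; have [_ C1 _] := hC.
transitivity (mu C (box (1, 1))) => //.
rewrite (copula_muE hC); last exact: unit_square11.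
by rewrite (C1 1 _).1// ler01 lexx.
Qed.

(** The two predicates [is_copula_measure] coincide, so [xget] makes the same choice. *)
Lemma mu_congr C D : eq_on_square C D -> mu C = mu D.
Proof.
move=> CD; congr (xget _ _); apply/funext => P; apply/propext.
by split=> H p sp; rewrite H// CD.
Qed.

Lemma symm_congr g C D : eq_on_square C D -> symm g C = symm g D.
Proof. by move=> CD; rewrite /symm (mu_congr CD). Qed.

Lemma measurable_D4_preimage g A : D4 g -> measurable A -> measurable (g @^-1` A).
Proof. by move=> Dg mA; rewrite -[X in measurable X]setTI; exact: measurable_D4. Qed.

Lemma mu_symm g C : D4 g -> mu C unit_square = 1%E ->
  forall A, measurable A -> mu (symm g C) A = mu C (g @^-1` A).
Proof.
move=> Dg C1; have [P PE] := pushforward_probability (mu C) (measurable_D4 Dg).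
move=> A mA; rewrite (@mu_unique _ P) ?PE//.
  by rewrite /pushforward preimage_D4_square.
move=> p sp; rewrite PE /symm fineK// fin_num_measure//.
by apply: measurable_D4_preimage => //; exact: measurable_box.
Qed.

Lemma symm_comp g h C : D4 g -> D4 h -> mu C unit_square = 1%E ->
  symm (g \o h) C = symm g (symm h C).
Proof.
move=> Dg Dh C1; apply/funext => p; rewrite /symm /pushforward mu_symm//.
by apply: measurable_D4_preimage => //; exact: measurable_box.
Qed.

End symmetries.

(** * Closed formulas for the eight images of a copula *)

Section symm_copula.
Context {R : realType}.
Implicit Types (C D : R * R -> R) (g : R * R -> R * R) (p : R * R).

Definition transpose C p := C (p.2, p.1).

(** If [C] is the copula of (U, V), this is the copula of (1 - U, V). *)
Definition reflect1 C p := p.2 - C (1 - p.1, p.2).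

Lemma copula_transpose C : is_copula C -> is_copula (transpose C).
Proof.
move=> [C0 C1 C2]; rewrite /transpose; split=> /=.
- by move=> u /C0[].
- by move=> u /C1[].
- move=> u1 u2 v1 v2 u10 u12 u21 v10 v12 v21.
  by have := C2 _ _ _ _ v10 v12 v21 u10 u12 u21; lra.
Qed.

Lemma copula_reflect1 C : is_copula C -> is_copula (reflect1 C).
Proof.
move=> [C0 C1 C2]; rewrite /reflect1; split=> /=.
- move=> u u01; have u01' : 0 <= 1 - u <= 1 by lra.
  by rewrite (C0 _ u01').1 !subr0 (C1 _ u01).2 subrr.
- move=> u u01; have u01' : 0 <= 1 - u <= 1 by lra.
  by rewrite (C1 _ u01').1 subrr (C0 _ u01).2; split; lra.
- move=> u1 u2 v1 v2 u10 u12 u21 v10 v12 v21.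
  have := C2 (1 - u2) (1 - u1) v1 v2; lra.
Qed.

Lemma D4_id : D4 (@idfun (R * R)).
Proof. by apply/D4_mem; rewrite mem_head. Qed.

Lemma D4_pi : D4 (@d4pi R).
Proof. by move=> G [_ sG]; apply: sG; left. Qed.

Lemma D4_sigma1 : D4 (@sigma1 R).
Proof. by move=> G [_ sG]; apply: sG; right. Qed.

Lemma D4_comp g h : @D4 R g -> D4 h -> D4 (g \o h).
Proof. by move=> Dg Dh G GG; case: (GG) => -[_ Gc] _; apply: Gc; [exact: Dg|exact: Dh]. Qed.

Lemma symm_id C : is_copula C -> eq_on_square (symm id C) C.
Proof. by move=> hC p sp; rewrite /symm/pushforward preimage_id (copula_muE hC). Qed.

Lemma symm_pi C : is_copula C -> eq_on_square (symm d4pi C) (transpose C).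
Proof.
move=> hC p sp; rewrite /symm/pushforward.
rewrite (_ : _ @^-1` _ = box (p.2, p.1)) ?(copula_muE hC)//.
  by case: sp.
by apply/seteqP; split=> q [].
Qed.

(* The vertical line through [1 - p.1] is null, by uniformity of the first
   marginal. *)
Lemma symm_sigma1 C : is_copula C -> eq_on_square (symm sigma1 C) (reflect1 C).
Proof.
move=> hC [u v] [/=]; rewrite !in_itv/= => u01 v01.
have [C0 C1 _] := hC.
have muE a b : 0 <= a <= 1 -> 0 <= b <= 1 -> mu C (box (a, b)) = (C (a, b))%:E.
  by move=> a01 b01; rewrite (copula_muE hC)//; split; rewrite /= in_itv.
have i11 : 0 <= (1 : R) <= 1 by rewrite ler01 lexx.
have muD a : 0 <= a <= 1 ->
    mu C (box (1, v) `\` box (a, v)) = (v - C (a, v))%:E.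
  move=> a01; transitivity (mu C (box (1%R, v)) - mu C (box (a, v)))%E; last first.
    by rewrite !muE// -EFinB (C1 _ v01).2.
  rewrite measureD; [|exact: measurable_box|exact: measurable_box|].
    rewrite setIidr// => q; rewrite /box/setX/= !in_itv/= => -[/andP[-> qa] ->].
    by rewrite (le_trans qa)//; case/andP: a01.
  by rewrite -ge0_fin_numE// fin_num_measure//; exact: measurable_box.
set A := sigma1 @^-1` box (u, v).
have mA : measurable A.
  by apply: measurable_D4_preimage; [exact: D4_sigma1|exact: measurable_box].
suff AE : mu C A = (v - C (1 - u, v))%:E by rewrite /symm /pushforward AE.
have u01' : 0 <= 1 - u <= 1 by lra.
have AP q : A q <-> 1 - u <= q.1 <= 1 /\ 0 <= q.2 <= v.
  rewrite /A /box/= !in_itv/=; split => -[qu ->]; split => //.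
    by rewrite /sigma1/= in qu; lra.
  by rewrite /sigma1/=; lra.
(* The preimage contains the line [q.1 = 1 - u], which the difference of boxes omits: one bound is
   an inclusion, the other needs an approximation. *)
apply/eqP; rewrite eq_le; apply/andP; split; last first.
  rewrite -muD//; apply: le_measure; rewrite ?inE//.
    by apply: measurableD; exact: measurable_box.
  move=> q; rewrite /box/setX/= !in_itv/= => -[[/andP[q0 q1] qv] nq].
  apply/AP; split=> //; rewrite q1 andbT leNgt; apply/negP => qu.
  by apply: nq; rewrite q0 qv ltW.
have [u1|u1] := eqVneq u 1.
  rewrite u1 subrr (C0 _ v01).2 subr0 -(C1 _ v01).2 -muE//.
  apply: le_measure; rewrite ?inE//; first exact: measurable_box.
  move=> q /AP[qu qv]; rewrite /box/setX/= !in_itv/= qv.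
  by move: qu; rewrite u1 subrr.
(* The number [a] is strictly left of [1 - u], which is positive in this case, and at distance at
   most [e]; the Lipschitz bound in the first variable, obtained by transposition, controls the
   excess. *)
apply/lee_addgt0Pr => e e0; pose a := Num.max 0 (1 - u - e).
have a0 : 0 <= a by rewrite le_max lexx.
have ae : 1 - u - e <= a by rewrite le_max lexx orbT.
have au : a < 1 - u.
  rewrite gt_max ltrBlDr ltrDl e0 andbT subr_gt0 lt_neqAle u1.
  by case/andP: u01.
have a01 : 0 <= a <= 1.
  by rewrite a0 (le_trans (ltW au))//; case/andP: u01'.
apply: (@le_trans _ _ (mu C (box (1, v) `\` box (a, v)))).
  apply: le_measure; rewrite ?inE//.
    by apply: measurableD; exact: measurable_box.
  move=> q /AP[/andP[qu q1] qv]; split; rewrite /box/setX/= !in_itv/=.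
    by rewrite q1 qv andbT (le_trans _ qu)//; case/andP: u01'.
  by move=> [/andP[_ qa] _]; have := lt_le_trans au (le_trans qu qa); rewrite ltxx.
have u1' : 1 - u <= 1 by case/andP: u01'.
have := copula_lipschitz (copula_transpose hC) v01 a0 (ltW au) u1'.
by rewrite muD// -EFinD lee_fin /transpose/=; lra.
Qed.

Lemma symm_pi_comp g C D : is_copula C -> is_copula D -> D4 g ->
  eq_on_square (symm g C) D ->
  eq_on_square (symm (d4pi \o g) C) (transpose D).
Proof.
move=> hC hD Dg gCD p sp; rewrite symm_comp//; [|exact: D4_pi|].
  by rewrite (symm_congr _ gCD) symm_pi.
exact: copula_mu_square.
Qed.

Lemma symm_sigma1_comp g C D : is_copula C -> is_copula D -> D4 g ->
  eq_on_square (symm g C) D ->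
  eq_on_square (symm (sigma1 \o g) C) (reflect1 D).
Proof.
move=> hC hD Dg gCD p sp; rewrite symm_comp//; [|exact: D4_sigma1|].
  by rewrite (symm_congr _ gCD) symm_sigma1.
exact: copula_mu_square.
Qed.

(** Each symmetry is a word in [d4pi] and [sigma1], so its formula is the corresponding chain of
    [transpose] and [reflect1]. *)
Lemma symm_formulas C u v : is_copula C -> 0 <= u <= 1 -> 0 <= v <= 1 ->
  [/\ symm id C (u, v) = C (u, v),
      symm d4pi C (u, v) = C (v, u),
      symm sigma1 C (u, v) = v - C (1 - u, v),
      symm sigma2 C (u, v) = u - C (u, 1 - v) &
  [/\ symm rho C (u, v) = u + v - 1 + C (1 - u, 1 - v),
      symm (sigma1 \o d4pi) C (u, v) = v - C (v, 1 - u),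
      symm (d4pi \o sigma1) C (u, v) = u - C (1 - v, u) &
      symm (d4pi \o rho) C (u, v) = u + v - 1 + C (1 - v, 1 - u)]].
Proof.
move=> hC u01 v01.
have hCp := copula_transpose hC; have hCs := copula_reflect1 hC.
have hCsp := copula_reflect1 hCp; have hCs2 := copula_transpose hCsp.
have Dp := D4_pi; have Ds := D4_sigma1.
have Dsp := D4_comp Ds Dp; have Ds2 : D4 sigma2 := D4_comp Dp Dsp.
have Dr : D4 rho := D4_comp Ds Ds2.
have e_pi := symm_pi hC; have e_s := symm_sigma1 hC.
have e_sp := symm_sigma1_comp hC hCp Dp e_pi.
have e_s2 : eq_on_square (symm sigma2 C) _ := symm_pi_comp hC hCsp Dsp e_sp.
have e_r : eq_on_square (symm rho C) _ := symm_sigma1_comp hC hCs2 Ds2 e_s2.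
have e_ps := symm_pi_comp hC hCs Ds e_s.
have e_pr := symm_pi_comp hC (copula_reflect1 hCs2) Dr e_r.
have sp : unit_square (u, v) by split; rewrite /= in_itv.
split; first exact: symm_id.
- exact: e_pi.
- exact: e_s.
- exact: e_s2.
- split; [rewrite e_r//|exact: e_sp|exact: e_ps|rewrite e_pr//];
    by rewrite /transpose /reflect1/=; ring.
Qed.

End symm_copula.

(** * The operator [Theta] *)

Section mixtures.
Context {R : realType}.
Implicit Types (C D : R * R -> R) (g h : R * R -> R * R) (p : R * R).
Variable w : (R * R -> R * R) -> R.
Hypotheses (w_ge0 : forall g, D4 g -> 0 <= w g).
Hypothesis w_sum1 : \sum_(g \in D4) w g = 1.

Lemma w_seq_sum1 : \sum_(g <- d4_elements) w g = 1.
Proof. by rewrite fsbig_seq ?D4_uniq// -D4E. Qed.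

Lemma measurable_square : measurable (@unit_square R).
Proof. exact: (measurable_box (1, 1)). Qed.

(** The mixture of the image measures has mass 1 on the square and the right values on boxes, so
    uniqueness identifies it; integrals follow by linearity and change of variables. *)
Lemma mu_Theta C : mu C unit_square = 1%E ->
  (forall A, measurable A ->
    mu (Theta w C) A =
    (\sum_(g <- d4_elements) (w g)%:E * mu C (g @^-1` A))%E) /\
  forall f : R * R -> R, measurable_fun unit_square f ->
    (forall p, unit_square p -> 0 <= f p) ->
    (\int[mu (Theta w C)]_(p in unit_square) (f p)%:E =
    \sum_(g <- d4_elements) (w g)%:E *
      \int[mu C]_(p in unit_square) (f (g p))%:E)%E.
Proof.
move=> C1.
have /choice[P PE] g : exists P : probability (R * R)%type R,
    D4 g -> P = pushforward (mu C) g :> (set (R * R) -> \bar R).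
  have [Dg|nDg] := pselect (D4 g); last by exists (mu C).
  have [P PE] := pushforward_probability (mu C) (measurable_D4 Dg).
  by exists P.
(* [msum] takes a family indexed by all naturals; the default [id] keeps the weights nonnegative
   past the eighth. *)
pose G n := nth id (@d4_elements R) n.
have DG n : D4 (G n).
  apply/D4_mem; rewrite /G; have [n8|n8] := ltnP n (size (@d4_elements R)).
    exact: mem_nth.
  by rewrite nth_default// mem_head.
pose k n : {nonneg R} := NngNum (w_ge0 (DG n)).
pose m_ n : {measure set (R * R) -> \bar R} := mscale (k n) (P (G n)).
have mE A : msum m_ 8 A =
    (\sum_(g <- d4_elements) (w g)%:E * mu C (g @^-1` A))%E.
  rewrite /msum (big_nth id) big_mkord; apply: eq_bigr => n _.
  by rewrite [LHS](_ : _ = ((w (G n))%:E * P (G n) A)%E)// PE.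
have mT B : (forall g, D4 g -> mu C (g @^-1` B) = 1%E) -> msum m_ 8 B = 1%E.
  move=> B1; rewrite mE -w_seq_sum1 -sumEFin.
  by apply: eq_big_seq => g /D4_mem Dg; rewrite B1// mule1.
have m1 : msum m_ 8 setT = 1%E.
  by apply: mT => g _; rewrite preimage_setT probability_setT.
have [M ME] := probability_of_measure m1.
have MA A : measurable A -> mu (Theta w C) A = M A.
  apply: mu_unique.
    by rewrite ME; apply: mT => g Dg; rewrite preimage_D4_square.
  move=> p sp; rewrite ME [LHS]mE ThetaE -sumEFin; apply: eq_big_seq => g /D4_mem Dg.
  rewrite EFinM /symm fineK// fin_num_measure//.
  by apply: measurable_D4_preimage => //; exact: measurable_box.
split=> [A mA|f mf f0]; first by rewrite MA// ME [LHS]mE.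
have mEf : measurable_fun unit_square (EFin \o f) by exact/measurable_EFinP.
rewrite (eq_measure_integral (msum m_ 8)); last first.
  by move=> A mA _; rewrite -ME -MA.
rewrite ge0_integral_measure_sum//; last exact: measurable_square.
rewrite (big_nth id) big_mkord; apply: eq_bigr => n _.
rewrite (@ge0_integral_mscale _ _ _ (P (G n)) _ measurable_square) //.
congr (_ * _)%E.
transitivity (\int[pushforward (mu C) (G n)]_(p in unit_square) (f p)%:E)%E.
  by rewrite -PE.
rewrite ge0_integral_pushforward//; [|exact: measurable_D4|exact: measurable_square|].
  by rewrite preimage_D4_square.
by move=> p; rewrite inE; exact: f0.
Qed.

(** Acting after [Theta w] composes on the left, acting before it ([Theta_symm]) on the right; (S1)
    compares the two sums. *)
Lemma symm_Theta g C p : D4 g -> mu C unit_square = 1%E ->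
  symm g (Theta w C) p = \sum_(h <- d4_elements) w h * symm (g \o h) C p.
Proof.
move=> Dg C1; rewrite /symm /pushforward (mu_Theta C1).1; last first.
  by apply: measurable_D4_preimage => //; exact: measurable_box.
have mh h : h \in d4_elements -> mu C (h @^-1` (g @^-1` box p)) \is a fin_num.
  move=> /D4_mem Dh; apply: fin_num_measure; apply: measurable_D4_preimage => //.
  by apply: measurable_D4_preimage => //; exact: measurable_box.
rewrite big_seq -sum_fine => [|h hd]; last by rewrite fin_numM// mh.
by rewrite [RHS]big_seq; apply: eq_bigr => h hd; rewrite fineM// mh.
Qed.

Lemma Theta_symm g C p : D4 g -> mu C unit_square = 1%E ->
  Theta w (symm g C) p = \sum_(h <- d4_elements) w h * symm (h \o g) C p.
Proof.
move=> Dg C1; rewrite ThetaE; apply: eq_big_seq => h /D4_mem Dh.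
by rewrite symm_comp.
Qed.

End mixtures.

(** * Integrals against copula measures *)

Section integrals.
Context {R : realType}.
Implicit Types (C D : R * R -> R) (g h : R * R -> R * R) (p : R * R).
Implicit Types (P : probability (R * R)%type R).

(* A distribution function is measurable by Fubini: its values are the measures
   of the sections of the set of all [(p, s)] with [s] in [box p]. *)
Lemma measurable_mu_box P : measurable_fun setT (fun p => fine (P (box p))).
Proof.
pose E := [set z : (R * R) * (R * R) | [&& 0 <= z.2.1, z.2.1 <= z.1.1,
  0 <= z.2.2 & z.2.2 <= z.1.2]].
have mE : measurable E.
  have : measurable_fun setT (fun z : (R * R) * (R * R) => [&& 0 <= z.2.1,
      z.2.1 <= z.1.1, 0 <= z.2.2 & z.2.2 <= z.1.2]).
    have m1 : measurable_fun setT (fun z : (R * R) * (R * R) => z.1.1).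
      exact: measurableT_comp.
    have m2 : measurable_fun setT (fun z : (R * R) * (R * R) => z.1.2).
      exact: measurableT_comp.
    have m3 : measurable_fun setT (fun z : (R * R) * (R * R) => z.2.1).
      exact: measurableT_comp.
    have m4 : measurable_fun setT (fun z : (R * R) * (R * R) => z.2.2).
      exact: measurableT_comp.
    by apply: measurable_and; [|apply: measurable_and; [|apply: measurable_and]];
      exact: measurable_fun_ler.
  by move=> /(_ measurableT [set true]); rewrite setTI; apply.
apply: measurableT_comp => //.
rewrite (_ : (fun p => P (box p)) = P \o xsection E).
  exact: measurable_fun_xsection.
apply/funext => p; congr (P _); apply/seteqP; split=> s;
  rewrite /xsection /E /box /setX/= inE/= !in_itv/=.
  by move=> [/andP[-> ->] /andP[-> ->]].
by move=> /and4P[-> -> -> ->].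
Qed.

Lemma symm_bounds g C p : D4 g -> 0 <= symm g C p <= 1.
Proof.
move=> Dg; have mb := measurable_D4_preimage Dg (measurable_box p).
rewrite /symm /pushforward fine_ge0//= -lee_fin fineK ?fin_num_measure//.
exact: probability_le1.
Qed.

Lemma measurable_symm g C : D4 g -> mu C unit_square = 1%E ->
  measurable_fun setT (symm g C).
Proof.
move=> Dg C1; have -> : symm g C = (fun p => fine (mu (symm g C) (box p))).
  by apply/funext => p; rewrite mu_symm//; exact: measurable_box.
exact: measurable_mu_box.
Qed.

Lemma copula_bounds C p : is_copula C -> unit_square p -> 0 <= C p <= 1.
Proof.
by move=> hC sp; rewrite -(symm_id hC sp); apply: symm_bounds; exact: D4_id.
Qed.

Lemma measurable_copula_comp g C : is_copula C -> D4 g ->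
  measurable_fun unit_square (C \o g).
Proof.
(* Off the square [C] is arbitrary; [symm id C] is a measurable function agreeing with it on the
   square. *)
move=> hC Dg; apply: (eq_measurable_fun (symm id C \o g)).
  move=> p; rewrite inE => sp /=; rewrite symm_id//; exact: D4_square.
apply: measurable_funTS; apply: measurableT_comp.
  by apply: measurable_symm; [exact: D4_id|exact: copula_mu_square].
exact: measurable_D4.
Qed.

Lemma integrable_bounded P (f : R * R -> R) : measurable_fun unit_square f ->
  (forall p, unit_square p -> 0 <= f p <= 1) ->
  P.-integrable unit_square (EFin \o f).
Proof.
move=> mf f01; have msq := @measurable_square R.
apply: (@le_integrable _ _ _ P _ msq _ (EFin \o cst 1)).
- exact/measurable_EFinP.
- by move=> p /f01/andP[f0 f1]; rewrite /= lee_fin normr1 ger0_norm.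
- exact: finite_measure_integrable_cst.
Qed.

Lemma Rintegral_sum P (s : seq (R * R -> R * R)) (c : (R * R -> R * R) -> R)
    (F : (R * R -> R * R) -> R * R -> R) :
  (forall g, g \in s -> P.-integrable unit_square (EFin \o F g)) ->
  \int[P]_(p in unit_square) (\sum_(g <- s) c g * F g p) =
  \sum_(g <- s) c g * \int[P]_(p in unit_square) F g p.
Proof.
have msq := @measurable_square R.
elim: s => [|g s IH] intF.
  rewrite big_nil (@eq_Rintegral _ _ _ _ _ (cst 0)) ?Rintegral_cst ?mul0r//.
  by move=> p _; rewrite big_nil.
have intg : P.-integrable unit_square (EFin \o F g).
  by apply: intF; rewrite mem_head.
have ints h : h \in s -> P.-integrable unit_square (EFin \o F h).
  by move=> hs; apply: intF; rewrite inE hs orbT.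
rewrite big_cons -IH// -RintegralZl// -RintegralD//.
- by apply: eq_Rintegral => p _; rewrite big_cons.
- by rewrite (_ : _ \o _ = (fun p => (c g)%:E * (EFin \o F g) p)%E)//; exact: integrableZl.
- rewrite (_ : _ \o _ = (fun p => \sum_(h <- s | h \in s)
      ((c h)%:E * (EFin \o F h) p))%E).
    by apply: integrable_sum => // h hs; apply: integrableZl => //; exact: ints.
  by apply/funext => p /=; rewrite -sumEFin big_seq.
Qed.

Lemma integral_symm g C (f : R * R -> R) : D4 g -> mu C unit_square = 1%E ->
  measurable_fun unit_square f -> (forall p, unit_square p -> 0 <= f p) ->
  (\int[mu (symm g C)]_(p in unit_square) (f p)%:E =
   \int[mu C]_(p in unit_square) (f (g p))%:E)%E.
Proof.
move=> Dg C1 mf f0; have msq := @measurable_square R.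
have [P PE] := pushforward_probability (mu C) (measurable_D4 Dg).
rewrite (eq_measure_integral P) => [|A mA _].
  transitivity (\int[pushforward (mu C) g]_(p in unit_square) (f p)%:E)%E.
    by rewrite -PE.
  rewrite ge0_integral_pushforward//.
  - by rewrite preimage_D4_square.
  - exact: measurable_D4.
  - exact/measurable_EFinP.
  - by move=> p; rewrite inE lee_fin; exact: f0.
transitivity (pushforward (mu C) g A); first exact: mu_symm.
by rewrite -PE.
Qed.

Lemma copula_mu_halfplane C (a : R) : is_copula C ->
  mu C (`]-oo, a]%classic `*` setT) = (clamp a)%:E.
Proof.
move=> hC; have [C0 C1 _] := hC; have msq := @measurable_square R.
have mA : measurable (`]-oo, a]%classic `*` [set: R]).
  by apply: measurableX => //; exact: measurable_itv.
have i11 : 0 <= (1 : R) <= 1 by rewrite ler01 lexx.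
transitivity (mu C ((`]-oo, a]%classic `*` setT) `&` unit_square)).
  by apply: probability_setI => //; exact: copula_mu_square.
have [a0|a0] := ltP a 0.
  rewrite clamp_le0 ?ltW// (_ : _ `&` _ = set0) ?measure0//.
  apply/seteqP; split=> // x [[]]; rewrite /= !in_itv/= => xa _ [].
  by rewrite /= !in_itv/= => /andP[x0 _]; have := le_trans x0 xa; rewrite leNgt a0.
rewrite (_ : _ `&` _ = box (clamp a, 1)).
  rewrite (copula_muE hC) ?(C1 _ (clamp01 a)).1//.
  by split; rewrite /= in_itv/= ?clamp01.
rewrite /clamp max_r//; apply/seteqP; split=> x; rewrite /box/setX/= !in_itv/= le_min.
  by move=> [[-> _] []]; rewrite /= !in_itv/= => /andP[-> ->] ->.
by move=> [/and3P[x0 -> x1] x2]; split=> //; split; rewrite /= in_itv/= ?x0.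
Qed.

(** The integral depends only on the law of the first coordinate, which is uniform for every
    copula. *)
Lemma integral_fst_unique C D : is_copula C -> is_copula D ->
  (\int[mu C]_(p in unit_square) (p.1)%:E =
   \int[mu D]_(p in unit_square) (p.1)%:E)%E.
Proof.
move=> hC hD; have msq := @measurable_square R.
have strip (E : R * R -> R) : is_copula E ->
    (\int[mu E]_(p in unit_square) (p.1)%:E =
     \int[pushforward (mu E) fst]_(x in `[0%R, 1%R]%classic) x%:E)%E.
  move=> hE; have muE0 : mu E (~` unit_square) = 0%E.
    by rewrite probability_setC// copula_mu_square// subee.
  rewrite ge0_integral_pushforward//; last first.
    by move=> x; rewrite inE/= in_itv/= lee_fin => /andP[].
  rewrite [RHS](@ge0_negligible_integral _ _ _ _ _ (~` unit_square)).
  - congr (integral _ _ _); apply/seteqP; split=> p.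
      by move=> [p1 p2]; split => //; rewrite /setC/= => -[].
    by move=> [_]; rewrite /setC/= => /contrapT.
  - exact: measurableC.
  - by rewrite -[X in measurable X]setTI; apply: measurable_fst.
  - by apply/measurable_EFinP; apply: measurable_funTS.
  - by move=> p; rewrite /= in_itv/= lee_fin => /andP[].
  - exact: muE0.
rewrite !strip//; apply: eq_measure_integral => A mA _.
have [m1 m1E] := measure_of_cylinder (mu C) (@measurableT _ R).
have [m2 m2E] := measure_of_cylinder (mu D) (@measurableT _ R).
have preE E : pushforward (mu E) fst A = mu E (A `*` setT).
  by congr (mu E _); apply/seteqP; split => p //; case.
rewrite [LHS]preE [RHS]preE -m1E -m2E; apply: eq_measure_cdf mA => a.
by rewrite m1E m2E !copula_mu_halfplane.
Qed.

(** Reflection by [sigma1] gives another copula, so U and 1 - U have the same mean, and these means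
    add up to 1. *)
Lemma integral_fst C : is_copula C ->
  \int[mu C]_(p in unit_square) p.1 = 2^-1.
Proof.
move=> hC; have msq := @measurable_square R; have C1 := copula_mu_square hC.
have hC' := copula_reflect1 hC.
have sq01 p : unit_square p -> 0 <= p.1 <= 1.
  by case; rewrite /= in_itv.
have intf : (mu C).-integrable unit_square (EFin \o fst).
  by apply: integrable_bounded => //; exact: measurable_funTS.
have intg : (mu C).-integrable unit_square (EFin \o (fun p => 1 - p.1)).
  apply: integrable_bounded => [|p /sq01]; last by lra.
  by apply: measurable_funTS; apply: measurable_funB.
have H1 : \int[mu C]_(p in unit_square) p.1 =
    \int[mu C]_(p in unit_square) (1 - p.1).
  rewrite /Rintegral (integral_fst_unique hC hC').
  rewrite -(mu_congr (symm_sigma1 hC)) integral_symm//; first exact: D4_sigma1.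
    exact: measurable_funTS.
  by move=> p /sq01/andP[].
have := RintegralD msq intf intg; rewrite -H1.
rewrite (@eq_Rintegral _ _ _ _ _ (cst 1)) => [|p _]; last by rewrite /= addrC subrK.
by rewrite Rintegral_cst// mul1r [X in fine X]C1 => /= {C1}; lra.
Qed.

Lemma integral_snd C : is_copula C ->
  \int[mu C]_(p in unit_square) p.2 = 2^-1.
Proof.
move=> hC; rewrite -(integral_fst (copula_transpose hC)) /Rintegral.
rewrite -(mu_congr (symm_pi hC)) integral_symm//.
- exact: D4_pi.
- exact: copula_mu_square.
- exact: measurable_funTS.
- by move=> p []; rewrite /= in_itv/= => /andP[].
Qed.

End integrals.

(** * Particular copulas *)

Section examples.
Context {R : realType}.

Lemma copula_Pi : is_copula (@copPi R).
Proof.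
rewrite /copPi; split=> /=.
- by move=> u _; rewrite mulr0 mul0r.
- by move=> u _; rewrite mulr1 mul1r.
- by move=> u1 u2 v1 v2 *; nra.
Qed.

Lemma copula_M : is_copula (@copM R).
Proof.
rewrite /copM; split=> /=.
- by move=> u /andP[u0 u1]; rewrite min_r// min_l.
- by move=> u /andP[u0 u1]; rewrite min_l// min_r.
- move=> u1 u2 v1 v2 u10 u12 u21 v10 v12 v21.
  case: (leP u2 v2) => ?; case: (leP u2 v1) => ?;
    case: (leP u1 v2) => ?; case: (leP u1 v1) => ?; lra.
Qed.

(* A perturbation [u v + a(u) b(v)] of [copPi]: it is a copula because [a] and
   [b] are 1-Lipschitz and vanish at 0 and 1, and it is not radially symmetric
   because [a(u) <> a(1 - u)]. *)
Definition cop_asym (p : R * R) : R :=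
  p.1 * p.2 + p.1 ^+ 2 * (1 - p.1) * (p.2 * (1 - p.2)).

Lemma copula_asym : is_copula cop_asym.
Proof.
rewrite /cop_asym; split=> /=.
- by move=> u _; split; ring.
- by move=> u _; split; ring.
- move=> u1 u2 v1 v2 u10 u12 u21 v10 v12 v21.
  pose da := u2 ^+ 2 * (1 - u2) - u1 ^+ 2 * (1 - u1).
  pose db := v2 * (1 - v2) - v1 * (1 - v1).
  have da1 : 0 <= u2 - u1 - da.
    rewrite (_ : _ - da = (u2 - u1) * (1 - (u1 + u2) + (u1 ^+ 2 + u1 * u2 + u2 ^+ 2))).
      by apply: mulr_ge0; nra.
    by rewrite /da; ring.
  have da2 : 0 <= u2 - u1 + da.
    rewrite (_ : _ + da = (u2 - u1) * (1 + (u1 + u2) - (u1 ^+ 2 + u1 * u2 + u2 ^+ 2))).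
      by apply: mulr_ge0; nra.
    by rewrite /da; ring.
  have db1 : 0 <= v2 - v1 - db.
    rewrite (_ : _ - db = (v2 - v1) * (v1 + v2)); last by rewrite /db; ring.
    by apply: mulr_ge0; lra.
  have db2 : 0 <= v2 - v1 + db.
    rewrite (_ : _ + db = (v2 - v1) * (2 - v1 - v2)); last by rewrite /db; ring.
    by apply: mulr_ge0; lra.
  (* The sum of these two products is twice [(u2 - u1) * (v2 - v1) + da * db], that is, twice the
     volume of the rectangle. *)
  have := mulr_ge0 da1 db1; have := mulr_ge0 da2 db2.
  by rewrite /da /db; lra.
Qed.

End examples.

(** * Conjugation in the symmetry group *)

Section D4_algebra.
Context {R : realType}.
Local Notation pi := (@d4pi R).
Local Notation rho := (@rho R).
Local Notation sigma1 := (@sigma1 R).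
Local Notation sigma2 := (@sigma2 R).

Lemma D4_cases (Q : (R * R -> R * R) -> Prop) :
  Q id -> Q pi -> Q sigma1 -> Q sigma2 -> Q rho -> Q (sigma1 \o pi) ->
  Q (pi \o sigma1) -> Q (pi \o rho) -> forall g, D4 g -> Q g.
Proof.
move=> Q1 Q2 Q3 Q4 Q5 Q6 Q7 Q8 g /D4_mem; rewrite !inE.
by do 7?[case/orP => [/eqP->//|]] => /eqP->.
Qed.

Lemma D4_rhoC (g : R * R -> R * R) : D4 g -> rho \o g = g \o rho.
Proof.
move: g; apply: D4_cases;
  by apply/funext => -[x y]; congr pair; rewrite /=; ring.
Qed.

(** [pi] and [pi \o rho] are the reflections in the two diagonals, which every symmetry of the
    square either preserves or exchanges. *)
Lemma D4_piJ (g : R * R -> R * R) : D4 g ->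
  (pi \o g = g \o pi /\ (pi \o rho) \o g = g \o (pi \o rho)) \/
  (pi \o g = g \o (pi \o rho) /\ (pi \o rho) \o g = g \o pi).
Proof.
move: g; apply: D4_cases;
  first [by left; split; apply/funext => -[x y]; congr pair; rewrite /=; ring
        |by right; split; apply/funext => -[x y]; congr pair; rewrite /=; ring].
Qed.

End D4_algebra.

(** * Necessity and sufficiency of the weight conditions *)

Section invariance.
Context {R : realType}.
Implicit Types (C D : R * R -> R) (p : R * R).
Local Notation pi := (@d4pi R).
Local Notation rho := (@rho R).
Local Notation sigma1 := (@sigma1 R).
Local Notation sigma2 := (@sigma2 R).

Lemma big_D4 (F : (R * R -> R * R) -> R) :
  \sum_(g <- d4_elements) F g = F id + F pi + F sigma1 + F sigma2 + F rho +
    F (sigma1 \o pi) + F (pi \o sigma1) + F (pi \o rho).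
Proof. by rewrite /d4_elements !big_cons big_nil; ring. Qed.

Lemma integral_centered D : is_copula D ->
  \int[mu D]_(p in unit_square) (p.1 + p.2 - 1) = 0.
Proof.
move=> hD; have msq := @measurable_square R.
have sq01 p : unit_square p -> 0 <= p.1 <= 1 /\ 0 <= p.2 <= 1.
  by case; rewrite /= !in_itv.
have int1 : (mu D).-integrable unit_square (EFin \o fst).
  by apply: integrable_bounded; [exact: measurable_funTS|move=> p /sq01[]].
have int2 : (mu D).-integrable unit_square (EFin \o snd).
  by apply: integrable_bounded; [exact: measurable_funTS|move=> p /sq01[]].
have intc : (mu D).-integrable unit_square (EFin \o cst 1).
  exact: finite_measure_integrable_cst.
rewrite (RintegralB (f1 := fun p => p.1 + p.2))//.
  rewrite RintegralD// integral_fst// integral_snd// Rintegral_cst//.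
  by rewrite mul1r [X in fine X]copula_mu_square//=; field.
by rewrite (_ : _ \o _ = (EFin \o fst) \+ (EFin \o snd))%E//; exact: integrableD.
Qed.

(** For [rho] and [pi \o rho] the two integrands differ by [p.1 + p.2 - 1], which integrates to 0
    since both marginals have mean 1/2; for the other two they agree on the square. *)
Lemma integral_symm_copula C D g : is_copula C -> is_copula D ->
  g \in [:: id; pi; rho; pi \o rho] ->
  \int[mu D]_(p in unit_square) symm g C p =
  \int[mu D]_(p in unit_square) C (g p).
Proof.
move=> hC hD; have msq := @measurable_square R.
have sq01 p : unit_square p -> 0 <= p.1 <= 1 /\ 0 <= p.2 <= 1.
  by case; rewrite /= !in_itv.
have shift f : D4 f -> (forall p, unit_square p ->
      symm f C p = (p.1 + p.2 - 1) + C (f p)) ->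
    \int[mu D]_(p in unit_square) symm f C p =
    \int[mu D]_(p in unit_square) C (f p).
  move=> Df fC; have intC : (mu D).-integrable unit_square (EFin \o (C \o f)).
    apply: integrable_bounded; first exact: measurable_copula_comp.
    by move=> p sp; apply: (copula_bounds hC); exact: D4_square.
  rewrite (@eq_Rintegral _ _ _ _ _ (fun p => symm f C p - C (f p) + C (f p))); last first.
    by move=> p _; rewrite subrK.
  rewrite RintegralD//.
    rewrite (@eq_Rintegral _ _ _ _ _ (fun p => p.1 + p.2 - 1)).
      by rewrite integral_centered// add0r.
    by move=> p; rewrite inE => sp; rewrite fC// addrK.
  rewrite (_ : _ \o _ = ((EFin \o symm f C) \- (EFin \o (C \o f))))%E//.
  apply: integrableB => //; apply: integrable_bounded.
    by apply: measurable_funTS; apply: measurable_symm => //; exact: copula_mu_square.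
  by move=> p _; exact: symm_bounds.
rewrite !inE => /or4P[] /eqP ->.
- by apply: eq_Rintegral => p; rewrite inE => sp; rewrite symm_id.
- by apply: eq_Rintegral => p; rewrite inE => sp; rewrite symm_pi.
- apply: shift => [|[u v] /sq01[u01 v01]]; first by apply/D4_mem; rewrite !inE eqxx !orbT.
  by have [_ _ _ _ [-> _ _ _]] := symm_formulas hC u01 v01.
- apply: shift => [|[u v] /sq01[u01 v01]]; first by apply/D4_mem; rewrite !inE eqxx !orbT.
  by have [_ _ _ _ [_ _ _ ->]] := symm_formulas hC u01 v01.
Qed.

Variable w : (R * R -> R * R) -> R.
Hypotheses (w_ge0 : forall g, D4 g -> 0 <= w g).
Hypothesis w_sum1 : \sum_(g \in D4) w g = 1.

(** On the left [Theta] expands the integrand, on the right ([Q_Theta_r]) the measure; (S3) thus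
    compares integrals of [symm g C] with those of [C \o g]. *)
Lemma Q_Theta_l C D : is_copula C -> is_copula D ->
  Q (Theta w C) D = 4 * (\sum_(g <- d4_elements)
    w g * \int[mu D]_(p in unit_square) symm g C p) - 1.
Proof.
move=> hC hD; congr (4 * _ - 1); rewrite -Rintegral_sum.
  by apply: eq_Rintegral => p _; rewrite ThetaE.
move=> g /D4_mem Dg; apply: integrable_bounded.
  by apply: measurable_funTS; apply: measurable_symm => //; exact: copula_mu_square.
by move=> p _; exact: symm_bounds.
Qed.

Lemma Q_Theta_r C D : is_copula C -> is_copula D ->
  Q C (Theta w D) = 4 * (\sum_(g <- d4_elements)
    w g * \int[mu D]_(p in unit_square) C (g p)) - 1.
Proof.
move=> hC hD; congr (4 * _ - 1).
have mC : measurable_fun unit_square C.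
  exact: (measurable_copula_comp hC D4_id).
rewrite /Rintegral (mu_Theta w_ge0 w_sum1 (copula_mu_square hD)).2//; last first.
  by move=> p sp; have /andP[] := copula_bounds hC sp.
have intC g : g \in d4_elements ->
    (\int[mu D]_(p in unit_square) (C (g p))%:E)%E \is a fin_num.
  move=> /D4_mem Dg; apply: integrable_fin_num; first exact: measurable_square.
  apply: (@integrable_bounded _ _ (C \o g)); first exact: measurable_copula_comp.
  by move=> p sp; apply: (copula_bounds hC); exact: D4_square.
rewrite big_seq -sum_fine => [|g gd]; last by rewrite fin_numM// intC.
by rewrite [RHS]big_seq; apply: eq_bigr => g gd; rewrite fineM// intC.
Qed.

Lemma S2_weights : S2 (Theta w) ->
  [/\ w sigma1 = 0, w sigma2 = 0, w (sigma1 \o pi) = 0 & w (pi \o sigma1) = 0].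
Proof.
move=> [_ SM]; have := w_seq_sum1 w_sum1; rewrite big_D4.
have w0 g : g \in d4_elements -> 0 <= w g by move=> /D4_mem; exact: w_ge0.
have w01 : 0 <= w sigma1 by apply: w0; rewrite !inE eqxx ?orbT.
have w02 : 0 <= w sigma2 by apply: w0; rewrite !inE eqxx ?orbT.
have w03 : 0 <= w (sigma1 \o pi) by apply: w0; rewrite !inE eqxx ?orbT.
have w04 : 0 <= w (pi \o sigma1) by apply: w0; rewrite !inE eqxx ?orbT.
have half : 0 <= (2^-1 : R) <= 1 by lra.
have [e1 e2 e3 e4 [e5 e6 e7 e8]] := symm_formulas copula_M half half.
have half2 : @unit_square R (2^-1, 2^-1) by split; rewrite /= in_itv.
(* The equation says that the weights of [id], [pi], [rho] and [pi \o rho] already sum to 1, so the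
   four other nonnegative weights vanish. *)
have := SM _ half2; rewrite ThetaE big_D4 e1 e2 e3 e4 e5 e6 e7 e8 /copM/=.
rewrite (_ : 1 - 2^-1 = 2^-1); last by field.
by rewrite minxx => H1 H2 {e1 e2 e3 e4 e5 e6 e7 e8}; split; lra.
Qed.

Lemma S1_weights : S1 (Theta w) ->
  [/\ w sigma1 = 0, w sigma2 = 0, w (sigma1 \o pi) = 0 & w (pi \o sigma1) = 0] ->
  w pi = w (pi \o rho).
Proof.
move=> S1T [w1 w2 w3 w4].
have u01 : 0 <= (2^-1 : R) <= 1 by lra.
have v01 : 0 <= (4^-1 : R) <= 1 by lra.
have suv : @unit_square R (2^-1, 4^-1) by split; rewrite /= in_itv.
have mu1 := copula_mu_square (@copula_asym R).
have := S1T _ _ copula_asym (@D4_sigma1 R) _ suv.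
rewrite Theta_symm ?symm_Theta//; [|exact: D4_sigma1..].
rewrite !big_D4 w1 w2 w3 w4 !mul0r !addr0 (D4_rhoC (@D4_sigma1 R)).
rewrite (_ : (pi \o rho) \o sigma1 = sigma1 \o pi); last first.
  by apply/funext => -[x y]; congr pair; rewrite /=; ring.
rewrite (_ : sigma1 \o (pi \o rho) = pi \o sigma1); last first.
  by apply/funext => -[x y]; congr pair; rewrite /=; ring.
rewrite -[id \o sigma1]/(sigma1 \o id).
(* What remains is [w pi - w (pi \o rho)] times the difference of two images of [cop_asym]. At (1/2,
   1/4) these are 1/8 - 3/256 and 1/8 - 9/256, so the factor is nonzero. *)
have [_ _ _ _ [_ e6 e7 _]] := symm_formulas copula_asym u01 v01.
by rewrite e6 e7 /cop_asym/=; lra.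
Qed.

Hypothesis w_pi : w pi = w (pi \o rho).
Hypotheses (w_sigma1 : w sigma1 = 0) (w_sigma2 : w sigma2 = 0).
Hypotheses (w_sigma1pi : w (sigma1 \o pi) = 0) (w_pisigma1 : w (pi \o sigma1) = 0).

(** With [pi] and [pi \o rho] under one weight, exchanging them by conjugation is mere commutativity
    of addition. *)
Lemma big_D4_weights (F : (R * R -> R * R) -> R) :
  \sum_(g <- d4_elements) w g * F g =
  w id * F id + w rho * F rho + w pi * (F pi + F (pi \o rho)).
Proof.
rewrite big_D4 w_sigma1 w_sigma2 w_sigma1pi w_pisigma1 -w_pi; ring.
Qed.

Lemma weights_S1 : S1 (Theta w).
Proof.
move=> C g hC Dg p sp; have C1 := copula_mu_square hC.
rewrite Theta_symm// symm_Theta// !big_D4_weights D4_rhoC//.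
by have [[-> ->]|[-> ->]] := D4_piJ Dg => //; congr (_ + _ * _); exact: addrC.
Qed.

Lemma weights_S2 : S2 (Theta w).
Proof.
have := w_seq_sum1 w_sum1; under eq_bigr do rewrite -[w _]mulr1.
rewrite big_D4_weights !mulr1 => W1; have {W1} W1 : w id = 1 - w rho - 2 * w pi by lra.
split=> -[u v] [/=]; rewrite !in_itv/= => u01 v01.
  have [e1 e2 _ _ [e5 _ _ e8]] := symm_formulas copula_Pi u01 v01.
  by rewrite ThetaE big_D4_weights e1 e2 e5 e8 W1 /copPi/=; ring.
have [e1 e2 _ _ [e5 _ _ e8]] := symm_formulas copula_M u01 v01.
rewrite ThetaE big_D4_weights e1 e2 e5 e8 W1 /copM/=.
(* The images under [rho] and [pi \o rho] become [u + v - Num.max u v], which is [Num.min u v]. *)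
rewrite (_ : Num.min (1 - u) (1 - v) = 1 - Num.max u v); last first.
  by case: (leP u v) => uv; [rewrite min_r//|rewrite min_l//]; lra.
rewrite (_ : Num.min (1 - v) (1 - u) = 1 - Num.max u v); last first.
  by case: (leP u v) => uv; [rewrite min_l//|rewrite min_r//]; lra.
by rewrite [Num.min v u]minC; case: (leP u v) => _; ring.
Qed.

Lemma weights_S3 : S3 (Theta w).
Proof.
move=> C D hC hD; rewrite Q_Theta_l// Q_Theta_r// !big_D4_weights.
by rewrite !integral_symm_copula// !inE eqxx ?orbT.
Qed.

End invariance.

Theorem proposition4p2 (R : realType) (w : (R * R -> R * R) -> R)
    (w_ge0 : forall g, D4 g -> 0 <= w g)
    (w_sum1 : \sum_(g \in D4) w g = 1) :
  [/\ S1 (Theta w), S2 (Theta w) & S3 (Theta w)] <->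
  w d4pi = w (d4pi \o rho) /\
  [/\ w sigma1 = 0, w sigma2 = 0, w (sigma1 \o d4pi) = 0 &
      w (d4pi \o sigma1) = 0].
Proof.
split=> [[S1T S2T _]|[w_pi [w1 w2 w3 w4]]].
  have w0 := S2_weights w_ge0 w_sum1 S2T.
  by split=> //; exact: S1_weights.
by split; [exact: weights_S1|exact: weights_S2|exact: weights_S3].
Qed.
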